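(* Let $c:\{0,1\}^n\to\mathbb{R}$ be a cost function and $p\ge 1$. For QAOA$_p$ with parameters $\gamma_1,\beta_1,\dots,\gamma_p,\beta_p\in\mathbb{R}$, the cost expectation satisfies $$\langle C\rangle_p=\langle C\rangle_0-\frac{2}{2^n}\Big(\sum_{1\le i\le j\le p}\gamma_i\beta_j\Big)\sum_{x\in\{0,1\}^n}c(x)\,dc(x)+\cdots$$ where the terms not shown are of order four or higher in $\gamma_1,\beta_1,\dots,\gamma_p,\beta_p$ (i.e. all terms of total degree at most $3$ in the power series of $\langle C\rangle_p$ in the $2p$ angles are displayed).
   Context: Work on $n$ qubits with computational basis $\{|x\rangle : x\in\{0,1\}^n\}$. For a cost function $c:\{0,1\}^n\to\mathbb{R}$, the cost Hamiltonian is $C=\sum_x c(x)|x\rangle\langle x|$. The mixing Hamiltonian is $B=\sum_{j=1}^n X_j$, and $|s\rangle=2^{-n/2}\sum_x|x\rangle$. The QAOA$_p$ state is $e^{-i\beta_pB}e^{-i\gamma_pC}\cdots e^{-i\beta_1B}e^{-i\gamma_1C}|s\rangle$, and $\langle C\rangle_p$ is the expectation value of $C$ in this state; $\langle C\rangle_0=\langle s|C|s\rangle=2^{-n}\sum_xc(x)$. With $x^{(j)}$ denoting $x$ with its $j$th bit flipped, $\partial_jc(x)=c(x^{(j)})-c(x)$ and $dc(x)=\sum_{j=1}^n\partial_jc(x)$. *)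

(* Defs.v *)
From HB Require Import structures.
From mathcomp Require Import all_boot all_order all_algebra finmap.
From mathcomp Require Import all_classical all_reals all_analysis.
From mathcomp Require Import complex.
From mathcomp.analysis.showcase Require summability.

Set Implicit Arguments.
Unset Strict Implicit.
Unset Printing Implicit Defensive.

Import Order.TTheory GRing.Theory Num.Theory numFieldNormedType.Exports.
Local Open Scope classical_set_scope.
Local Open Scope complex_scope.
Local Open Scope sesquilinear_scope.
Local Open Scope ring_scope.

Definition expmx (K : numFieldType) (N : nat) (A : 'M[K]_N) : 'M[K]_N :=
  lim (series (fun k => (k`!)%:R^-1 *: A ^+ k) @ \oo).

Definition bits (n : nat) := {ffun 'I_n -> bool}.

Definition bit_flip (n : nat) (j : 'I_n) (x : bits n) : bits n :=
  [ffun k => if k == j then ~~ x k else x k].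

Definition partial_diff (R : realType) (n : nat) (j : 'I_n) (c : bits n -> R)
    (x : bits n) : R :=
  c (bit_flip j x) - c x.

Definition diff_sum (R : realType) (n : nat) (c : bits n -> R) (x : bits n) : R :=
  \sum_(j < n) partial_diff j c x.

(* Operators on n qubits are matrices of size 2 ^ n, whose rows and columns are
   indexed by bit strings through [enum_rank]. *)
Notation state R n := 'cV[R[i]]_#|{: bits n}|.
Notation operator R n := 'M[R[i]]_#|{: bits n}|.

Definition ket (R : realType) (n : nat) (x : bits n) : state R n :=
  delta_mx (enum_rank x) 0.

Definition costH (R : realType) (n : nat) (c : bits n -> R) : operator R n :=
  \sum_(x : bits n) (c x)%:C *: (ket R x *m (ket R x)^t*).

Definition pauliX (R : realType) (n : nat) (j : 'I_n) : operator R n :=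
  \sum_(x : bits n) ket R (bit_flip j x) *m (ket R x)^t*.

Definition mixH (R : realType) (n : nat) : operator R n :=
  \sum_(j < n) pauliX R j.

Definition plus_state (R : realType) (n : nat) : state R n :=
  ((Num.sqrt (2 ^+ n))^-1)%:C *: \sum_(x : bits n) ket R x.

(* The layers are applied in increasing order of the index, so that the factors
   of the last layer are leftmost. *)
Definition qaoa_state (R : realType) (n p : nat) (c : bits n -> R)
    (gamma beta : 'I_p -> R) : state R n :=
  foldl (fun (psi : state R n) (k : 'I_p) =>
           expmx ((- 'i%C * (beta k)%:C) *: mixH R n) *m
           (expmx ((- 'i%C * (gamma k)%:C) *: costH c) *m psi))
        (plus_state R n) (enum 'I_p).

Definition quantum_expectation (R : realType) (n : nat) (A : operator R n)
    (psi : state R n) : R[i] :=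
  (psi^t* *m (A *m psi)) 0 0.

Definition qaoa_cost (R : realType) (n p : nat) (c : bits n -> R)
    (gamma beta : 'I_p -> R) : R[i] :=
  quantum_expectation (costH c) (qaoa_state c gamma beta).

Definition initial_cost (R : realType) (n : nat) (c : bits n -> R) : R[i] :=
  quantum_expectation (costH c) (plus_state R n).

(* Exponents of the gamma's and of the beta's. *)
Definition multi_index (p : nat) : choiceType :=
  ({ffun 'I_p -> nat} * {ffun 'I_p -> nat})%type.

Definition total_degree (p : nat) (m : multi_index p) : nat :=
  (\sum_(k < p) (m.1 k + m.2 k))%N.

Definition angle_monomial (R : realType) (p : nat) (m : multi_index p)
    (gamma beta : 'I_p -> R) : R :=
  \prod_(k < p) (gamma k ^+ m.1 k * beta k ^+ m.2 k).

(* [f] is the sum of a power series in the 2p angles, without terms of total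
   degree less than d. The series converges for all angles, along the finite
   sets of multi-indices ordered by inclusion, hence absolutely. *)
Definition power_series_of_order_ge (R : realType) (p d : nat)
    (f : ('I_p -> R) -> ('I_p -> R) -> R) : Prop :=
  exists a : multi_index p -> R,
    (forall m, (total_degree m < d)%N -> a m = 0) /\
    (forall gamma beta : 'I_p -> R,
       summability.partial_sum (fun m => a m * angle_monomial m gamma beta)
         @ summability.totally --> f gamma beta).

(* Main.v *)
Require Import Defs.
From mathcomp Require Import all_boot all_order all_algebra finmap.
From mathcomp Require Import all_classical all_reals all_analysis.
From mathcomp Require Import complex ring lra.

(** Diagonalising the two Hamiltonians turns the cost expectation into a finite
    sum [f = \sum_u w_u e^{i L_u}] with complex weights [w_u] and real linear forms
    [L_u] in the angles.  As [f] is real, and as negating all angles conjugates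
    the state (both Hamiltonians being real matrices), [f] is even and equals
    [\sum_u Re w_u cos L_u].  Hence the odd orders vanish, and subtracting orders 0
    and 2 leaves [\sum_u Re w_u (cos L_u - 1 + L_u ^ 2 / 2)], whose power series
    starts in degree 4.  Order 2 is the second moment
    [\sum_u w_u (i L_u) ^ 2 / 2].  Moments are multiplicative as Taylor coefficients
    are, so it is computed layer by layer, using [B |s> = n |s>]. *)

Set Implicit Arguments.
Unset Strict Implicit.
Unset Printing Implicit Defensive.

Import Order.TTheory GRing.Theory Num.Theory numFieldNormedType.Exports.
Local Open Scope classical_set_scope.
Local Open Scope complex_scope.
Local Open Scope sesquilinear_scope.
Local Open Scope ring_scope.

(** * Power series in the angles *)

#[local] Existing Instance summability.totally_filter.

(** The Cauchy product rule for exponential series. It is used twice: for products of truncated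
    exponentials and, at complex arguments, for the multiplicativity of moments. *)
Lemma exp_coeff_binomial (F : numFieldType) (x y : F) (d : nat) :
  \sum_(i < d.+1) x ^+ i / i`!%:R * (y ^+ (d - i) / (d - i)`!%:R) =
  (x + y) ^+ d / d`!%:R.
Proof.
rewrite addrC exprDn mulr_suml; apply: eq_bigr => -[i /= id] _.
rewrite ltnS in id.
have fN0 j : (j`!%:R : F) != 0 by rewrite pnatr_eq0 -lt0n fact_gt0.
rewrite -[X in _ = X / _]mulr_natr.
have -> : 'C(d, i)%:R = d`!%:R / (i`!%:R * (d - i)`!%:R) :> F.
  by rewrite -(bin_fact id) natrM natrM mulfK // mulf_neq0.
by field; rewrite !fN0.
Qed.

(** The bound [M] gives the finite sums of absolute values a supremum. A finite set [A] reaches it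
    up to e/2, so a finite [J] containing some [S N] that contains [A] adds less than e/2 to the sum
    over [S N]. Convergence along one exhausting sequence thus yields convergence of the net. *)
Lemma partial_sum_cvg (R : realType) (I : choiceType) (t : I -> R)
    (S : nat -> {fset I}) (M v : R) :
  (forall A : {fset I}, \forall N \near \oo, (A `<=` S N)%fset) ->
  (forall N, \sum_(i <- S N) `|t i| <= M) ->
  (fun N => \sum_(i <- S N) t i) @ \oo --> v ->
  summability.partial_sum t @ summability.totally --> v.
Proof.
move=> S_exh S_bnd S_cvg.
pose E : set R := range (fun A : {fset I} => \sum_(i <- A) `|t i|).
have subE (A B : {fset I}) (F : I -> R) : (A `<=` B)%fset ->
    \sum_(i <- B) F i = \sum_(i <- A) F i + \sum_(i <- (B `\` A)%fset) F i.
  move=> sAB; rewrite (big_fsetID _ (mem A)) /=; congr (_ + _).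
    apply: congr_big => //; congr (enum_fset _); apply/fsetP => x.
    by rewrite !inE /= andb_idl // => /(fsubsetP sAB).
  apply: congr_big => //; congr (enum_fset _); apply/fsetP => x.
  by rewrite !inE /= andbC.
have E_sup : has_sup E.
  split; first by exists (\sum_(i <- fset0) `|t i|), fset0.
  exists M => _ [A _ <-]; have [N _ /(_ N (leqnn N)) sAN] := S_exh A.
  apply: le_trans (S_bnd N); rewrite (subE A (S N)) // lerDl.
  by rewrite sumr_ge0.
apply/cvgrPdist_lt => e e0.
have e20 : 0 < e / 2 by rewrite divr_gt0.
have [_ [A _ <-] supA] := sup_adherent e20 E_sup.
move/cvgrPdist_lt/(_ _ e20): S_cvg => S_cvg.
have [N [sAN dN]] : exists N, (A `<=` S N)%fset /\ `|v - \sum_(i <- S N) t i| < e / 2.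
  by have [N _ /(_ N (leqnn N)) [? ?]] := filterI (S_exh A) S_cvg; exists N.
exists (S N) => // J /= sNJ.
rewrite /summability.partial_sum -(big_seq_fsetE _ J xpredT t) /=.
rewrite (subE (S N) J) // opprD addrA [e]splitr.
apply: le_lt_trans (ler_normB _ _) _; apply: ltrD => //.
apply: le_lt_trans (ler_norm_sum _ _ _) _.
have: \sum_(i <- J) `|t i| <= sup E by apply: ub_le_sup; [case: E_sup|exists J].
rewrite (subE (S N) J) // (subE A (S N)) //.
have : 0 <= \sum_(i <- (S N `\` A)%fset) `|t i| by rewrite sumr_ge0.
lra.
Qed.

(** Bounded exponents form a finite type of functions, over which a product of sums can be
    distributed. *)
Definition multi_index_of (p N : nat) (f : {ffun 'I_p -> 'I_N * 'I_N}) :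
    multi_index p :=
  ([ffun k => (f k).1 : nat], [ffun k => (f k).2 : nat]).

Lemma multi_index_of_inj (p N : nat) : injective (@multi_index_of p N).
Proof.
move=> f g [/ffunP e1 /ffunP e2]; apply/ffunP => k.
move: (e1 k) (e2 k); rewrite !ffunE => /val_inj h1 /val_inj h2.
by rewrite [f k]surjective_pairing h1 h2 -surjective_pairing.
Qed.

(** Each exponent is at most the total degree, so bounding the exponents by [N] loses no multi-index
    of degree below [N]. *)
Definition degree_lt (p N : nat) : {fset multi_index p} :=
  seq_fset tt [seq multi_index_of f
              | f <- enum {ffun 'I_p -> 'I_N * 'I_N} &
                (total_degree (multi_index_of f) < N)%N].

Lemma mem_degree_lt (p N : nat) (m : multi_index p) :
  (m \in degree_lt p N) = (total_degree m < N)%N.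
Proof.
rewrite seq_fsetE; apply/mapP/idP => [[f]|mN].
  by rewrite mem_filter => /andP[? _] ->.
have leN (k : 'I_p) : (m.1 k < N)%N /\ (m.2 k < N)%N.
  split; apply: leq_ltn_trans mN; rewrite /total_degree (bigD1 k) //= -addnA.
    exact: leq_addr.
  by rewrite addnCA leq_addr.
pose f := [ffun k : 'I_p => (Ordinal (leN k).1, Ordinal (leN k).2)].
have fE : multi_index_of f = m.
  by rewrite [m]surjective_pairing; congr pair; apply/ffunP => k; rewrite !ffunE.
by exists f => //; rewrite mem_filter mem_enum fE mN.
Qed.

Lemma sum_degree_lt (V : nmodType) (p N : nat) (F : multi_index p -> V) :
  \sum_(m <- degree_lt p N) F m =
  \sum_(f : {ffun 'I_p -> 'I_N * 'I_N} | (total_degree (multi_index_of f) < N)%N)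
    F (multi_index_of f).
Proof.
rewrite (perm_big _ (seq_fset_perm _ _)) /= undup_id; last first.
  rewrite map_inj_uniq; last exact: multi_index_of_inj.
  by rewrite filter_uniq // enum_uniq.
by rewrite big_map big_filter enumT.
Qed.

(** The term of index [m] when the exponential of the sum of all [x k] and [y k] is expanded as a
    product of exponential series. *)
Definition exp_term (R : realType) (p : nat) (x y : 'I_p -> R)
    (m : multi_index p) : R :=
  \prod_(k < p) (x k ^+ m.1 k / (m.1 k)`!%:R * (y k ^+ m.2 k / (m.2 k)`!%:R)).

(* The multinomial formula is read off the coefficients of a product of truncated
   exponential polynomials. *)
Section truncated_exponential.
Variable R : realType.

Let texp (N : nat) (x : R) : {poly R} := \sum_(i < N) (x ^+ i / i`!%:R) *: 'X^i.

(** Here [q] agrees with the series of $e^{xX}$ modulo $X^N$, a relation stable under products with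
    addition of the exponents. *)
Let good N (q : {poly R}) (x : R) := forall d, (d < N)%N -> q`_d = x ^+ d / d`!%:R.

Let good_texp N x : good N (texp N x) x.
Proof.
move=> d dN; rewrite /texp -(poly_def N (fun i => x ^+ i / i`!%:R)).
by rewrite coef_poly dN.
Qed.

Let good1 N : good N 1 0.
Proof. by move=> [|d] _; rewrite coef1 /= ?expr0 ?divr1 // expr0n mul0r. Qed.

Let goodM N q1 q2 x1 x2 : good N q1 x1 -> good N q2 x2 -> good N (q1 * q2) (x1 + x2).
Proof.
move=> g1 g2 d dN; rewrite coefM -exp_coeff_binomial.
apply: eq_bigr => -[i /= id] _; rewrite ltnS in id.
by rewrite g1 ?(leq_ltn_trans id) // g2 ?(leq_ltn_trans (leq_subr _ _)).
Qed.

(** The weight [g] sees only the degree: it is constantly 1 for the absolute bound, and a truncated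
    cosine sign pattern in the application. *)
Lemma sum_exp_term (p N : nat) (x y : 'I_p -> R) (g : nat -> R) :
  \sum_(m <- degree_lt p N) g (total_degree m) * exp_term x y m =
  \sum_(0 <= d < N) g d * ((\sum_k (x k + y k)) ^+ d / d`!%:R).
Proof.
rewrite sum_degree_lt big_mkord.
(* The coefficients of [Q] are computed twice: by [good] they are those of one exponential, and by
   distributing the product they are sums over the multi-indices of a given degree. *)
pose Q := \prod_(k < p) (texp N (x k) * texp N (y k)).
have Qgood : good N Q (\sum_k (x k + y k)).
  rewrite /Q; apply: (big_ind2 (fun q z => good N q z)).
  - exact: good1.
  - by move=> ? ? ? ?; exact: goodM.
  - by move=> k _; apply: goodM; exact: good_texp.
have QE : Q = \sum_(f : {ffun 'I_p -> 'I_N * 'I_N})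
    exp_term x y (multi_index_of f) *: 'X^(total_degree (multi_index_of f)).
  rewrite /Q; under eq_bigr => k _.
    rewrite /texp big_distrlr /= pair_bigA /=.
    over.
  rewrite bigA_distr_bigA; apply: eq_bigr => f _.
  under eq_bigr => k _ do rewrite -scalerAl -scalerAr scalerA -exprD.
  rewrite scaler_prod prodrXr /exp_term /total_degree /=.
  by congr (_ *: 'X^_); apply: eq_bigr => k _; rewrite !ffunE // mulrC.
under [RHS]eq_bigr => d _.
  rewrite -(Qgood d (ltn_ord d)) QE coef_sum mulr_sumr.
  under eq_bigr => f _ do rewrite coefZ coefXn.
  over.
rewrite exchange_big /= [RHS](bigID (fun f => (total_degree (multi_index_of f) < N)%N)) /=.
(* Exponents below [N] may still have total degree at least [N]; such terms meet no coefficient of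
   index [d] below [N]. *)
rewrite [X in _ = _ + X]big1 ?addr0 => [|f fN]; last first.
  apply: big1 => d _; case: eqP => [e|]; last by rewrite !mulr0.
  by rewrite -e ltn_ord in fN.
apply: eq_bigr => f fN; rewrite (bigD1 (Ordinal fN)) //= eqxx mulr1.
rewrite big1 ?addr0 // => d; rewrite -val_eqE /= => /negbTE ->.
by rewrite !mulr0.
Qed.

End truncated_exponential.

Lemma exp_term_abs (R : realType) (p : nat) (x y : 'I_p -> R) (m : multi_index p) :
  `|exp_term x y m| = exp_term (fun k => `|x k|) (fun k => `|y k|) m.
Proof.
rewrite normr_prod; apply: eq_bigr => k _.
by rewrite !normrM !normfV !normrX !normr_nat.
Qed.

(** Grouping by degree turns the sum over [degree_lt p N] into a partial sum of a one-variable
    series. Since [g] is bounded by 1, the absolute sums stay below the exponential of the sum of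
    all absolute values. *)
Lemma exp_term_series_cvg (R : realType) (p : nat) (x y : 'I_p -> R)
    (g : nat -> R) (v : R) :
  (forall d, `|g d| <= 1) ->
  series (fun d => g d * ((\sum_k (x k + y k)) ^+ d / d`!%:R)) @ \oo --> v ->
  summability.partial_sum (fun m => g (total_degree m) * exp_term x y m)
    @ summability.totally --> v.
Proof.
move=> g1 gv; pose z := \sum_k (`|x k| + `|y k|).
apply: (@partial_sum_cvg _ _ _ (degree_lt p) (expR z)).
- move=> A; pose N := (\max_(m <- A) total_degree m).+1.
  exists N => // N' /= NN'; apply/fsubsetP => m mA.
  by rewrite mem_degree_lt (leq_trans _ NN') // ltnS; exact: leq_bigmax_seq.
- move=> N; apply: le_trans (_ : series (exp_coeff z) N <= _).
    rewrite /series /= /exp_coeff /=.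
    under [leRHS]eq_bigr => d _ do rewrite -[_ / _]mul1r.
    rewrite -(sum_exp_term _ _ _ (fun=> 1)).
    apply: ler_sum => m _; rewrite normrM exp_term_abs ler_wpM2r //.
    by rewrite -exp_term_abs.
  rewrite /expR /=; apply: nondecreasing_cvgn_le; last exact: is_cvg_series_exp_coeff.
  apply/nondecreasing_seqP => k; rewrite /series /= big_nat_recr //= lerDl.
  rewrite /exp_coeff /= divr_ge0 // exprn_ge0 //.
  by apply: sumr_ge0 => i _; rewrite addr_ge0.
- apply: cvg_trans gv; apply: near_eq_cvg; near=> N.
  by rewrite sum_exp_term.
Unshelve. all: by end_near. Qed.

Lemma power_series_of_order_geD (R : realType) (p d : nat)
    (f g : ('I_p -> R) -> ('I_p -> R) -> R) :
  power_series_of_order_ge d f -> power_series_of_order_ge d g ->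
  power_series_of_order_ge d (fun x y => f x y + g x y).
Proof.
move=> [a [a0 fa]] [b [b0 gb]]; exists (fun m => a m + b m); split.
  by move=> m md; rewrite a0 // b0 // addr0.
move=> x y; rewrite (_ : summability.partial_sum _ = fun A =>
    summability.partial_sum (fun m => a m * angle_monomial m x y) A +
    summability.partial_sum (fun m => b m * angle_monomial m x y) A).
  exact: cvgD.
apply/funext => A; rewrite /summability.partial_sum -big_split /=.
by apply: eq_bigr => m _; rewrite mulrDl.
Qed.

Lemma power_series_of_order_geZ (R : realType) (p d : nat) (w : R)
    (f : ('I_p -> R) -> ('I_p -> R) -> R) :
  power_series_of_order_ge d f ->
  power_series_of_order_ge d (fun x y => w * f x y).
Proof.
move=> [a [a0 fa]]; exists (fun m => w * a m); split.
  by move=> m md; rewrite a0 // mulr0.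
move=> x y; rewrite (_ : summability.partial_sum _ = fun A =>
    w * summability.partial_sum (fun m => a m * angle_monomial m x y) A).
  by apply: cvgMr; exact: fa.
apply/funext => A; rewrite /summability.partial_sum mulr_sumr.
by apply: eq_bigr => m _; rewrite mulrA.
Qed.

Lemma power_series_of_order_ge_sum (R : realType) (p d : nat) (I : Type)
    (s : seq I) (f : I -> ('I_p -> R) -> ('I_p -> R) -> R) :
  (forall i, power_series_of_order_ge d (f i)) ->
  power_series_of_order_ge d (fun x y => \sum_(i <- s) f i x y).
Proof.
move=> fi; elim: s => [|i s IH].
  exists (fun=> 0); split => // x y.
  rewrite big_nil (_ : summability.partial_sum _ = fun=> 0); first exact: cvg_cst.
  by apply/funext => A; apply: big1 => m _; rewrite mul0r.
under boolp.eq_fun do under boolp.eq_fun do rewrite big_cons.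
exact: power_series_of_order_geD.
Qed.

Definition linform (R : realType) (p : nat) (l : ('I_p -> R) * ('I_p -> R))
    (gamma beta : 'I_p -> R) : R :=
  \sum_k (l.1 k * gamma k + l.2 k * beta k).

Lemma cos_linform_order4 (R : realType) (p : nat) (l : ('I_p -> R) * ('I_p -> R)) :
  power_series_of_order_ge 4 (fun gamma beta =>
    cos (linform l gamma beta) - 1 + linform l gamma beta ^+ 2 / 2).
Proof.
(* These are the signs of the cosine series, with the orders below 4 deleted. *)
pose g d : R := if (d < 4)%N then 0 else (~~ odd d)%:R * (-1) ^+ d./2.
exists (fun m => g (total_degree m) * exp_term l.1 l.2 m); split.
  by move=> m md; rewrite /g md mul0r.
move=> gamma beta.
have termE m : g (total_degree m) * exp_term l.1 l.2 m * angle_monomial m gamma beta =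
  g (total_degree m) * exp_term (fun k => l.1 k * gamma k) (fun k => l.2 k * beta k) m.
  rewrite -mulrA; congr (_ * _); rewrite -big_split; apply: eq_bigr => k _ /=.
  by rewrite !exprMn; ring.
under boolp.eq_fun do rewrite termE.
apply: exp_term_series_cvg => [d|].
  rewrite /g; case: ifP => _; first by rewrite normr0.
  by rewrite normrM normrX normrN1 expr1n mulr1 normr_nat lern1 leq_b1.
rewrite -/(linform l gamma beta); set L := linform _ _ _.
have : series (cos_coeff L) @ \oo --> cos L.
  by rewrite cos.unlock; exact: is_cvg_series_cos_coeff.
move=> coscvg.
have rcvg : (fun N => series (cos_coeff L) N - (1 - L ^+ 2 / 2)) @ \oo -->
    cos L - 1 + L ^+ 2 / 2.
  rewrite [cos L - 1 + _](_ : _ = cos L - (1 - L ^+ 2 / 2)); last by ring.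
  by apply: cvgB => //; exact: cvg_cst.
(* The first four cosine terms add up to $1 - L^2/2$, so from [N] = 4 on the two sequences
   coincide. *)
apply: cvg_trans rcvg; apply: near_eq_cvg; near=> N.
have N4 : (4 <= N)%N by near: N; exact: nbhs_infty_ge.
rewrite /= /series /= (big_cat_nat (leq0n 4) N4) /= [in RHS](big_cat_nat (leq0n 4) N4) /=.
rewrite addrAC; congr (_ + _).
  rewrite !big_nat_recl ?big_geq //= /cos_coeff /g /=.
  by rewrite !factS fact0; field.
rewrite big_nat_cond [RHS]big_nat_cond; apply: eq_bigr => d /andP[/andP[d4 _] _].
by rewrite /g ltnNge d4 /= /cos_coeff /= !mulrA.
Unshelve. all: by end_near. Qed.

(** * Matrix exponentials of Hermitian matrices *)

Lemma cvg_complex (R : realType) (u : nat -> R[i]) (a b : R) :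
  (fun k => complex.Re (u k)) @ \oo --> a ->
  (fun k => complex.Im (u k)) @ \oo --> b ->
  (u : nat -> (R[i] : numFieldType)) @ \oo --> (a +i* b : (R[i] : numFieldType)).
Proof.
move=> /cvgrPdist_lt ua /cvgrPdist_lt ub; apply/cvgrPdist_lt => -[e e'].
(* In the order of [R[i]], a positive number has zero imaginary part. *)
rewrite ltcE /= => /andP[/eqP-> e0].
have e20 : 0 < e / 2 by rewrite divr_gt0.
move: (ua _ e20) (ub _ e20) => {}ua {}ub.
near=> k.
have hR : `|a - complex.Re (u k)| < e / 2 by near: k.
have hI : `|b - complex.Im (u k)| < e / 2 by near: k.
have -> : a +i* b - u k =
    (a - complex.Re (u k))%:C + 'i%C * (b - complex.Im (u k))%:C.
  by case: (u k) => x y; simpc.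
apply: le_lt_trans (ler_normD _ _) _.
rewrite normrM !normc_def /= !(expr0n, expr1n, add0r, addr0, sqrtr1, mul1r) /=.
by rewrite !sqrtr_sqr -rmorphD /= ltcR [e]splitr ltrD.
Unshelve. all: by end_near. Qed.

Definition expi (R : realType) (t : R) : R[i] := cos t +i* sin t.

Lemma expi0 (R : realType) : expi (0 : R) = 1.
Proof. by rewrite /expi cos0 sin0. Qed.

Lemma expiD (R : realType) (s t : R) : expi (s + t) = expi s * expi t.
Proof. by rewrite /expi cosD sinD; simpc; rewrite [cos s * sin t + _]addrC. Qed.

Lemma conj_expi (R : realType) (t : R) : Num.conj (expi t) = expi (- t).
Proof. by rewrite /expi cosN sinN. Qed.

Lemma expi_series_cvg (R : realType) (t : R) :
  (series (fun k => k`!%:R^-1 * ('i%C * t%:C) ^+ k) :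
    nat -> (R[i] : numFieldType)) @ \oo --> (expi t : (R[i] : numFieldType)).
Proof.
have termE k : k`!%:R^-1 * ('i%C * t%:C) ^+ k =
    cos_coeff t k +i* sin_coeff t k.
  have iE : 'i%C ^+ k = (~~ odd k)%:R * (-1) ^+ k./2 +i*
                        ((odd k)%:R * (-1) ^+ k.-1./2) :> R[i].
    rewrite -[in LHS](odd_double_half k) -mul2n exprD exprM sqr_i.
    have -> : (-1) ^+ k./2 = ((-1) ^+ k./2)%:C :> R[i] by rewrite rmorphXn rmorphN1.
    case: (boolP (odd k)) => ko /=; last by rewrite expr0; simpc.
    rewrite expr1 -[k in k.-1](odd_double_half k) ko /= doubleK.
    by simpc.
  rewrite exprMn iE -rmorphXn /= -(rmorph_nat (real_complex R)) -fmorphV /=.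
  by simpc; congr (_ +i* _); rewrite mulrC.
apply: cvg_complex.
  rewrite (_ : (fun _ => _) = series (cos_coeff t)).
    by rewrite cos.unlock; exact: is_cvg_series_cos_coeff.
  apply/funext => n; rewrite /series /= (raddf_sum (@complex.Re R)).
  by apply: eq_bigr => k _; rewrite termE.
rewrite (_ : (fun _ => _) = series (sin_coeff t)).
  by rewrite sin.unlock; exact: is_cvg_series_sin_coeff.
apply/funext => n; rewrite /series /= (raddf_sum (@complex.Im R)).
by apply: eq_bigr => k _; rewrite termE.
Qed.

(** The [E j] are complete orthogonal idempotents indexed by coordinates rather than by distinct
    eigenvalues, so [d] may repeat values. *)
Definition spectral_resolution (R : realType) (N : nat) (H : 'M[R[i]]_N)
    (d : 'I_N -> R) (E : 'I_N -> 'M[R[i]]_N) : Prop :=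
  [/\ \sum_j E j = 1%:M,
      forall j k, E j *m E k = if j == k then E j else 0 &
      H = \sum_j (d j)%:C *: E j].

Lemma hermitian_spectral_resolution (R : realType) (N : nat) (H : 'M[R[i]]_N) :
  H \is hermsymmx -> exists d E, spectral_resolution H d E.
Proof.
move=> Hherm.
have /orthomx_spectralP HE := hermitian_normalmx Hherm.
have /mxOverP dreal := hermitian_spectral_diag_real Hherm.
have Punit := spectral_unit H.
set P := spectralmx H in HE Punit.
(* From $H = P^{-1} D P$, the rank-one idempotents are column j of $P^{-1}$ times row j of $P$; the
   entries of $D$ are real as $H$ is Hermitian. *)
exists (fun j => complex.Re (spectral_diag H 0 j)),
  (fun j => col j (invmx P) *m row j P); split.
- rewrite -(mulVmx Punit); apply/matrixP => a b.
  rewrite summxE [RHS]mxE; apply: eq_bigr => j _.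
  by rewrite mxE big_ord1 !mxE.
- move=> j k; rewrite mulmxA -[_ *m row j P *m _]mulmxA.
  have -> : row j P *m col k (invmx P) = (j == k)%:R%:M.
    apply/matrixP => a b; rewrite !ord1 !mxE eqxx mulr1n.
    have /matrixP/(_ j k) := mulmxV Punit; rewrite !mxE => <-.
    by apply: eq_bigr => l _; rewrite !mxE.
  rewrite mul_mx_scalar -scalemxAl; case: eqP => [->|_]; first by rewrite scale1r.
  by rewrite scale0r.
- rewrite {1}HE; apply/matrixP => a b.
  rewrite mul_mx_diag mxE summxE; apply: eq_bigr => j _.
  rewrite !mxE big_ord1 !mxE; have /complex_realP[r ->] := dreal 0 j.
  by rewrite mulrAC mulrC.
Qed.

Lemma spectral_resolution_exp (R : realType) (N : nat) (H : 'M[R[i]]_N) d E (z : R[i]) k :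
  spectral_resolution H d E ->
  (z *: H) ^+ k = \sum_j (z * (d j)%:C) ^+ k *: E j.
Proof.
case=> E1 EM ->; elim: k => [|k IH].
  rewrite expr0 -[LHS]/(1%:M) -E1.
  by apply: eq_bigr => j _; rewrite expr0 scale1r.
rewrite exprS IH -mulmxE scaler_sumr mulmx_suml; apply: eq_bigr => j _.
rewrite mulmx_sumr (bigD1 j) //= big1 ?addr0 => [|l lj]; last first.
  by rewrite scalerA -scalemxAl -scalemxAr EM eq_sym (negbTE lj) !scaler0.
by rewrite scalerA -scalemxAl -scalemxAr EM eqxx scalerA -exprS.
Qed.

Lemma spectral_resolution_series_cvg (R : realType) (N : nat) (H : 'M[R[i]]_N) d E (t : R) :
  spectral_resolution H d E ->
  (series (fun k => k`!%:R^-1 *: (('i%C * t%:C) *: H) ^+ k) :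
     nat -> 'M[(R[i] : numFieldType)]_N) @ \oo -->
  (\sum_j expi (d j * t) *: E j : 'M[(R[i] : numFieldType)]_N).
Proof.
move=> HE.
rewrite (_ : series _ = fun n => \sum_j
   (series (fun k => k`!%:R^-1 * ('i%C * (d j * t)%:C) ^+ k) n) *: E j); last first.
  apply/funext => n; rewrite /series /=.
  under eq_bigr => k _ do rewrite (spectral_resolution_exp _ _ HE) scaler_sumr.
  rewrite exchange_big /=; apply: eq_bigr => j _.
  rewrite scaler_suml; apply: eq_bigr => k _.
  by rewrite scalerA -mulrA -rmorphM /= [t * _]mulrC.
apply: cvg_big => [|j _]; first exact: add_continuous.
by apply: cvgZ; [exact: expi_series_cvg | exact: cvg_cst].
Qed.

Lemma expmx_spectral (R : realType) (N : nat) (H : 'M[R[i]]_N) d E (t : R) :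
  spectral_resolution H d E ->
  expmx (('i%C * t%:C) *: H : 'M[(R[i] : numFieldType)]_N) =
  \sum_j expi (d j * t) *: E j.
Proof.
by move=> HE; apply: cvg_lim;
  [exact: norm_hausdorff | exact: spectral_resolution_series_cvg].
Qed.

Lemma spectral_resolution_conj (R : realType) (N : nat) (H : 'M[R[i]]_N) d E :
  spectral_resolution H d E ->
  spectral_resolution (map_mx Num.conj H) d (fun j => map_mx Num.conj (E j)).
Proof.
case=> E1 EM ->; split.
- by rewrite -raddf_sum E1 /= map_mx1.
- by move=> j k; rewrite -map_mxM EM; case: eqP => // _; rewrite map_mx0.
- rewrite raddf_sum /=; apply: eq_bigr => j _.
  rewrite map_mxZ; congr (_ *: _).
  by apply/CrealP; apply/complex_realP; exists (d j).
Qed.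

(** The idempotents of a real [H] need not be real, but their conjugates resolve the same [H] with
    the same eigenvalues. Conjugation therefore only changes each $e^{i d_j t}$ into $e^{-i d_j
    t}$. *)
Lemma conj_expmx (R : realType) (N : nat) (H : 'M[R[i]]_N) (t : R) :
  H \is hermsymmx -> map_mx Num.conj H = H ->
  map_mx Num.conj (expmx (('i%C * t%:C) *: H : 'M[(R[i] : numFieldType)]_N)) =
  expmx (('i%C * (- t)%:C) *: H : 'M[(R[i] : numFieldType)]_N).
Proof.
move=> /hermitian_spectral_resolution[d [E HE]] Hreal.
have := spectral_resolution_conj HE; rewrite Hreal => HEc.
rewrite (expmx_spectral _ HE) (expmx_spectral _ HEc) raddf_sum /=.
by apply: eq_bigr => j _; rewrite map_mxZ mulrN -conj_expi.
Qed.

(** * Exponential sums and their moments *)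

Section exponential_sums.
Variables (R : realType) (p : nat).
Implicit Types (l : ('I_p -> R) * ('I_p -> R)) (gamma beta : 'I_p -> R).

Definition linform_add l l' : ('I_p -> R) * ('I_p -> R) :=
  (fun k => l.1 k + l'.1 k, fun k => l.2 k + l'.2 k).

Definition linform_scale (a : R) l : ('I_p -> R) * ('I_p -> R) :=
  (fun k => a * l.1 k, fun k => a * l.2 k).

Lemma linform_addE l l' gamma beta :
  linform (linform_add l l') gamma beta = linform l gamma beta + linform l' gamma beta.
Proof. by rewrite /linform -big_split; apply: eq_bigr => k _ /=; ring. Qed.

Lemma linform_scaleE a l gamma beta :
  linform (linform_scale a l) gamma beta = a * linform l gamma beta.
Proof. by rewrite /linform mulr_sumr; apply: eq_bigr => k _ /=; ring. Qed.

(** A formal sum of matrix weights times $e^{iL}$ with [L] a linear form. Keeping it as data lets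
    the homogeneous parts be read off the weights and forms, with no differentiation in the
    angles. *)
Definition expsum (m n : nat) :=
  seq ('M[R[i]]_(m, n) * (('I_p -> R) * ('I_p -> R))).

Definition expsum_eval m n (s : expsum m n) gamma beta : 'M[R[i]]_(m, n) :=
  \sum_(u <- s) expi (linform u.2 gamma beta) *: u.1.

(* The homogeneous part of degree k, in the angles, of [expsum_eval s]. *)
Definition moment m n (k : nat) (s : expsum m n) gamma beta : 'M[R[i]]_(m, n) :=
  \sum_(u <- s) (('i%C * (linform u.2 gamma beta)%:C) ^+ k / k`!%:R) *: u.1.

Definition expsum_mul m n q (s : expsum m n) (t : expsum n q) : expsum m q :=
  [seq (u.1 *m v.1, linform_add u.2 v.2) | u <- s, v <- t].

Definition expsum_adj m n (s : expsum m n) : expsum n m :=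
  [seq (u.1^t*, linform_scale (-1) u.2) | u <- s].

Definition expsum_lmul m n q (A : 'M[R[i]]_(q, m)) (s : expsum m n) : expsum q n :=
  [seq (A *m u.1, u.2) | u <- s].

Lemma expsum_mulE m n q (s : expsum m n) (t : expsum n q) gamma beta :
  expsum_eval (expsum_mul s t) gamma beta =
  expsum_eval s gamma beta *m expsum_eval t gamma beta.
Proof.
rewrite /expsum_eval big_allpairs_dep mulmx_suml; apply: eq_bigr => u _.
rewrite mulmx_sumr; apply: eq_bigr => v _ /=.
by rewrite linform_addE expiD -scalemxAl -scalemxAr scalerA.
Qed.

(** The Cauchy product of Taylor expansions: for each pair of weights, $(i(L+L'))^k/k!$ splits by
    the binomial theorem. *)
Lemma moment_mul m n q k (s : expsum m n) (t : expsum n q) gamma beta :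
  moment k (expsum_mul s t) gamma beta =
  \sum_(i < k.+1) moment i s gamma beta *m moment (k - i) t gamma beta.
Proof.
rewrite /moment big_allpairs_dep.
under [RHS]eq_bigr => i _ do rewrite mulmx_suml.
rewrite [RHS]exchange_big; apply: eq_bigr => u _ /=.
under [RHS]eq_bigr => i _ do rewrite mulmx_sumr.
rewrite [RHS]exchange_big; apply: eq_bigr => v _ /=.
under [RHS]eq_bigr => i _ do rewrite -scalemxAl -scalemxAr scalerA.
rewrite -scaler_suml linform_addE rmorphD /= mulrDr -exp_coeff_binomial.
by [].
Qed.

Lemma expsum_adjE m n (s : expsum m n) gamma beta :
  expsum_eval (expsum_adj s) gamma beta = (expsum_eval s gamma beta)^t*.
Proof.
rewrite /expsum_eval big_map linear_sum raddf_sum /=; apply: eq_bigr => u _ /=.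
by rewrite linform_scaleE mulN1r linearZ map_mxZ -conj_expi.
Qed.

Lemma moment_adj m n k (s : expsum m n) gamma beta :
  moment k (expsum_adj s) gamma beta = (moment k s gamma beta)^t*.
Proof.
rewrite /moment big_map linear_sum raddf_sum /=; apply: eq_bigr => u _ /=.
rewrite linform_scaleE mulN1r linearZ map_mxZ; congr (_ *: _).
rewrite rmorphM rmorphXn /= fmorphV rmorph_nat; congr (_ ^+ _ / _).
by apply/eqP; rewrite eq_complex /=; apply/andP; split; apply/eqP; ring.
Qed.

Lemma expsum_lmulE m n q (A : 'M[R[i]]_(q, m)) (s : expsum m n) gamma beta :
  expsum_eval (expsum_lmul A s) gamma beta = A *m expsum_eval s gamma beta.
Proof.
rewrite /expsum_eval big_map mulmx_sumr; apply: eq_bigr => u _ /=.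
by rewrite -scalemxAr.
Qed.

Lemma moment_lmul m n q k (A : 'M[R[i]]_(q, m)) (s : expsum m n) gamma beta :
  moment k (expsum_lmul A s) gamma beta = A *m moment k s gamma beta.
Proof.
rewrite /moment big_map mulmx_sumr; apply: eq_bigr => u _ /=.
by rewrite -scalemxAr.
Qed.

(** The eigenvalue [d j] contributes the weight [E j] with the form [d j] times [l]; resumming the
    k-th moment gives back the k-th term of the exponential series. *)
Lemma expsum_expmx (N : nat) (H : 'M[R[i]]_N) l : H \is hermsymmx ->
  exists s : expsum N N,
    (forall gamma beta, expsum_eval s gamma beta =
      expmx (('i%C * (linform l gamma beta)%:C) *: H : 'M[(R[i] : numFieldType)]_N)) /\
    (forall k gamma beta, moment k s gamma beta =
      k`!%:R^-1 *: (('i%C * (linform l gamma beta)%:C) *: H) ^+ k).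
Proof.
move=> /hermitian_spectral_resolution[d [E HE]].
exists [seq (E j, linform_scale (d j) l) | j <- enum 'I_N]; split.
  move=> gamma beta; rewrite (expmx_spectral _ HE) /expsum_eval big_map big_enum /=.
  by apply: eq_bigr => j _; rewrite linform_scaleE.
move=> k gamma beta; rewrite (spectral_resolution_exp _ _ HE) scaler_sumr.
rewrite /moment big_map big_enum /=; apply: eq_bigr => j _.
rewrite linform_scaleE scalerA; congr (_ *: _).
by rewrite mulrC rmorphM /= mulrA [in RHS]mulrAC -mulrA.
Qed.

End exponential_sums.

(** * Hamiltonians and states of n qubits *)

Section bit_strings.
Variables (R : realType) (n : nat).
Implicit Types (f g c : bits n -> R) (x y : bits n) (j : 'I_n).

Lemma bit_flipK j : involutive (bit_flip j).
Proof.
move=> x; apply/ffunP => k; rewrite !ffunE.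
by case: eqP => // _; rewrite negbK.
Qed.

Lemma conj_ket x : map_mx Num.conj (ket R x) = ket R x.
Proof. exact: map_delta_mx. Qed.

Lemma conj_real (r : R) : Num.conj r%:C = r%:C.
Proof. by apply/CrealP; apply/complex_realP; exists r. Qed.

Lemma conj_realZ m q (r : R) (A : 'M[R[i]]_(m, q)) :
  map_mx Num.conj (r%:C *: A) = r%:C *: map_mx Num.conj A.
Proof. by rewrite map_mxZ; congr (_ *: _); exact: conj_real. Qed.

Lemma ket_adj x : (ket R x)^t* = (ket R x)^T.
Proof. by rewrite -map_trmx conj_ket. Qed.

Lemma ket_orthonormal x y : (ket R y)^T *m ket R x = (y == x)%:R%:M.
Proof.
rewrite /ket trmx_delta mul_delta_mx_cond (inj_eq enum_rank_inj).
by apply/matrixP => a b; rewrite !ord1 !mxE mulr1n; case: eqP => _; rewrite mxE.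
Qed.

Lemma costH_real c : map_mx Num.conj (costH c) = costH c.
Proof.
rewrite /costH raddf_sum /=; apply: eq_bigr => x _.
by rewrite conj_realZ map_mxM ket_adj -map_trmx conj_ket.
Qed.

Lemma costH_sym c : (costH c)^T = costH c.
Proof.
rewrite /costH linear_sum /=; apply: eq_bigr => x _.
by rewrite linearZ /= trmx_mul ket_adj trmxK.
Qed.

Lemma mixH_real : map_mx Num.conj (mixH R n) = mixH R n.
Proof.
rewrite /mixH raddf_sum /=; apply: eq_bigr => j _.
rewrite /pauliX raddf_sum /=; apply: eq_bigr => x _.
by rewrite map_mxM ket_adj -map_trmx !conj_ket.
Qed.

Lemma mixH_sym : (mixH R n)^T = mixH R n.
Proof.
rewrite /mixH linear_sum /=; apply: eq_bigr => j _.
rewrite /pauliX linear_sum /= (reindex_inj (inv_inj (bit_flipK j))) /=.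
by apply: eq_bigr => x _; rewrite trmx_mul !ket_adj trmxK bit_flipK.
Qed.

(** On states with real amplitudes both Hamiltonians act as operators on functions of bit strings,
    which reduces matrix products to sums over [x]. *)
Definition real_state f : state R n := \sum_x (f x)%:C *: ket R x.

Lemma costH_real_state c f :
  costH c *m real_state f = real_state (fun x => c x * f x).
Proof.
rewrite mulmx_sumr; apply: eq_bigr => x _; rewrite -scalemxAr mulmx_suml.
rewrite (bigD1 x) //= big1 ?addr0 => [|y yx]; last first.
  by rewrite -scalemxAl -mulmxA ket_adj ket_orthonormal (negbTE yx) mul_mx_scalar
    scale0r scaler0.
rewrite -scalemxAl -mulmxA ket_adj ket_orthonormal eqxx mul_mx_scalar scale1r.
by rewrite scalerA -rmorphM mulrC.
Qed.

Lemma mixH_real_state f :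
  mixH R n *m real_state f = real_state (fun x => \sum_j f (bit_flip j x)).
Proof.
rewrite /real_state; under [RHS]eq_bigr => x _ do rewrite rmorph_sum scaler_suml.
rewrite exchange_big mulmx_suml; apply: eq_bigr => j _ /=.
rewrite [RHS](reindex_inj (inv_inj (bit_flipK j))) mulmx_sumr /=.
apply: eq_bigr => x _; rewrite bit_flipK -scalemxAr mulmx_suml; congr (_ *: _).
rewrite (bigD1 x) //= big1 ?addr0 => [|y yx]; last first.
  by rewrite -mulmxA ket_adj ket_orthonormal (negbTE yx) mul_mx_scalar scale0r.
by rewrite -mulmxA ket_adj ket_orthonormal eqxx mul_mx_scalar scale1r.
Qed.

Lemma conj_real_state f : map_mx Num.conj (real_state f) = real_state f.
Proof.
rewrite raddf_sum; apply: eq_bigr => x _ /=.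
by rewrite conj_realZ conj_ket.
Qed.

Lemma real_state_dot f g :
  ((real_state f)^T *m real_state g) 0 0 = (\sum_x f x * g x)%:C.
Proof.
have -> : (real_state f)^T = \sum_x (f x)%:C *: (ket R x)^T.
  by rewrite [LHS]linear_sum; apply: eq_bigr => x _; rewrite linearZ.
rewrite mulmx_suml summxE rmorph_sum; apply: eq_bigr => x _ /=.
rewrite -scalemxAl mxE mulmx_sumr summxE (bigD1 x) //= big1 => [|y yx].
  by rewrite -scalemxAr ket_orthonormal eqxx !mxE mulr1n mulr1 addr0 rmorphM.
by rewrite -scalemxAr ket_orthonormal eq_sym (negbTE yx) !mxE mulr0n mulr0.
Qed.

Lemma plus_stateE : plus_state R n = real_state (fun=> (Num.sqrt (2 ^+ n))^-1).
Proof. by rewrite /plus_state scaler_sumr. Qed.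

End bit_strings.

(** * Reality and conjugation symmetry of the cost expectation *)

Lemma real_symmetric_hermitian (R : realType) (N : nat) (H : 'M[R[i]]_N) :
  map_mx Num.conj H = H -> H^T = H -> H \is hermsymmx.
Proof. by move=> Hr Hs; rewrite is_hermitianmxE expr0 scale1r Hs Hr. Qed.

Lemma quantum_expectation_real (R : realType) (n : nat) (A : operator R n)
    (psi : state R n) :
  map_mx Num.conj A = A -> A^T = A ->
  Num.conj (quantum_expectation A psi) = quantum_expectation A psi.
Proof.
move=> Ar As; rewrite /quantum_expectation.
set M := psi^t* *m _.
have : M^t* = M.
  rewrite /M !trmx_mul !map_mxM /= As Ar mulmxA.
  rewrite -!map_trmx trmxK -map_mx_comp; congr (_ *m _).
  by apply/matrixP => a b; rewrite mxE /= conjCK.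
by move: M => M /(congr1 (fun A : 'M[R[i]]_1 => A 0 0)); rewrite !mxE.
Qed.

Lemma quantum_expectation_conj (R : realType) (n : nat) (A : operator R n)
    (psi : state R n) :
  map_mx Num.conj A = A ->
  quantum_expectation A (map_mx Num.conj psi) =
  Num.conj (quantum_expectation A psi).
Proof.
move=> Ar; rewrite /quantum_expectation -[in LHS]Ar map_trmx -!map_mxM mxE.
by [].
Qed.

(** The initial state is real, and conjugating each layer negates its angles because both
    Hamiltonians are real. Combined with the reality of the expectation, this makes the cost even in
    the angles. *)
Lemma qaoa_state_opp (R : realType) (n p : nat) (c : bits n -> R)
    (gamma beta : 'I_p -> R) :
  qaoa_state c (fun k => - gamma k) (fun k => - beta k) =
  map_mx Num.conj (qaoa_state c gamma beta).
Proof.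
rewrite /qaoa_state.
rewrite [in LHS](_ : plus_state R n = map_mx Num.conj (plus_state R n)); last first.
  by rewrite plus_stateE conj_real_state.
have conjE t H : H \is hermsymmx -> map_mx Num.conj H = H ->
    expmx ((- 'i%C * (- t)%:C) *: H : 'M[(R[i] : numFieldType)]_#|{: bits n}|) =
    map_mx Num.conj (expmx ((- 'i%C * t%:C) *: H : 'M[(R[i] : numFieldType)]_#|{: bits n}|)).
  move=> Hh Hr; rewrite !mulNr -!mulrN -!rmorphN conj_expmx //.
have Ch := real_symmetric_hermitian (costH_real c) (costH_sym c).
have Bh := real_symmetric_hermitian (mixH_real R n) (mixH_sym R n).
elim: (enum 'I_p) (plus_state R n) => [|k s IH] psi //=.
by rewrite -IH !map_mxM !conjE ?costH_real ?mixH_real.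
Qed.

(** * Second order expansion *)

(** The algebra of adding one layer with angles [g] and [h], where [z] stands for -i and [x] for C
    s. In the second-order version below, [w] is C C s and [y] is B C s. *)
Lemma first_order_step (K : numFieldType) (N : nat) (s x : 'cV[K]_N)
    (z G b g h nu : K) :
  z *: (G *: x + (b * nu) *: s) + (z * g) *: x + (z * h) *: (nu *: s) =
  z *: ((G + g) *: x + ((b + h) * nu) *: s).
Proof. by apply/matrixP => i j; rewrite !mxE; ring. Qed.

(** The new angle [h] pairs with every gamma so far, including the [g] of its own layer; hence [sg]
    grows by [(G + g) * h]. *)
Lemma second_order_step (K : numFieldType) (N : nat) (s x y w : 'cV[K]_N)
    (z G b g h nu sg : K) :
  z ^+ 2 *: ((G ^+ 2 / 2) *: w + (b ^+ 2 * nu ^+ 2 / 2) *: s + sg *: y +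
      ((G * b - sg) * nu) *: x) +
    (z * g) *: (z *: (G *: w + (b * nu) *: x)) +
    ((z * g) ^+ 2 / 2) *: w +
    (z * h) *: (z *: (G *: y + (b * nu) *: (nu *: s)) + (z * g) *: y) +
    ((z * h) ^+ 2 / 2) *: (nu *: (nu *: s)) =
  z ^+ 2 *: (((G + g) ^+ 2 / 2) *: w + ((b + h) ^+ 2 * nu ^+ 2 / 2) *: s +
      (sg + (G + g) * h) *: y +
      (((G + g) * (b + h) - (sg + (G + g) * h)) * nu) *: x).
Proof. by apply/matrixP => i j; rewrite !mxE; field. Qed.

Section second_order.
Variables (R : realType) (p N : nat).
Variables (C B : 'M[R[i]]_N) (s0 : 'cV[R[i]]_N) (nu : R).
Hypotheses (C_herm : C \is hermsymmx) (B_herm : B \is hermsymmx).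
Hypothesis B_s0 : B *m s0 = nu%:C *: s0.

Definition layers (gamma beta : 'I_p -> R) (s : seq 'I_p) (psi : 'cV[R[i]]_N) :=
  foldl (fun (psi : 'cV[R[i]]_N) (k : 'I_p) =>
    expmx ((- 'i%C * (beta k)%:C) *: B : 'M[(R[i] : numFieldType)]_N) *m
    (expmx ((- 'i%C * (gamma k)%:C) *: C : 'M[(R[i] : numFieldType)]_N) *m psi))
    psi s.

Lemma expsum_layer (H : 'M[R[i]]_N) (l : ('I_p -> R) * ('I_p -> R))
    (s : expsum R p N 1) : H \is hermsymmx ->
  exists s' : expsum R p N 1, forall gamma beta,
    let z := 'i%C * (linform l gamma beta)%:C in
    let v k := moment k s gamma beta in
    [/\ expsum_eval s' gamma beta =
          expmx (z *: H : 'M[(R[i] : numFieldType)]_N) *m expsum_eval s gamma beta,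
        moment 0 s' gamma beta = v 0,
        moment 1 s' gamma beta = v 1 + z *: (H *m v 0) &
        moment 2 s' gamma beta =
          v 2 + z *: (H *m v 1) + (z ^+ 2 / 2) *: (H *m (H *m v 0))].
Proof.
move=> /(expsum_expmx l)[t [tE tM]]; exists (expsum_mul t s) => gamma beta z v.
split; first by rewrite expsum_mulE tE.
- by rewrite moment_mul big_ord1 tM fact0 invr1 scale1r expr0 mul1mx.
- rewrite moment_mul !big_ord_recl big_ord0 addr0 !tM /= fact0 factS invr1.
  by rewrite !scale1r expr0 expr1 mul1mx -scalemxAl.
- rewrite moment_mul !big_ord_recl big_ord0 addr0 !tM /= !factS fact0.
  rewrite invr1 !scale1r expr0 expr1 mul1mx -scalemxAl addrA; congr (_ + _).
  rewrite [(_ *: H) ^+ 2]expr2 -mulmxE -!(scalemxAl, scalemxAr) !scalerA -mulmxA.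
  by congr (_ *: _); rewrite expr2 -mulrA mulrC.
Qed.

(** At order two, a pair gamma_i, beta_j gives B C s0 when i <= j, as B then acts after C. When j <
    i, B acts first on its eigenvector [s0] and gives [nu] times C s0; these pairs have total weight
    [G * b - sg]. *)
Lemma layers_second_order (m : nat) : (m <= p)%N ->
  exists s : expsum R p N 1, forall gamma beta,
    let G := \sum_(i < p | (i < m)%N) gamma i in
    let b := \sum_(j < p | (j < m)%N) beta j in
    let sg := \sum_(j < p | (j < m)%N) \sum_(i < p | (i <= j)%N) gamma i * beta j in
    [/\ expsum_eval s gamma beta = layers gamma beta (take m (enum 'I_p)) s0,
        moment 0 s gamma beta = s0,
        moment 1 s gamma beta =
          - 'i%C *: (G%:C *: (C *m s0) + (b * nu)%:C *: s0) &
        moment 2 s gamma beta =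
          (- 'i%C) ^+ 2 *: ((G ^+ 2 / 2)%:C *: (C *m (C *m s0)) +
            (b ^+ 2 * nu ^+ 2 / 2)%:C *: s0 +
            sg%:C *: (B *m (C *m s0)) +
            ((G * b - sg) * nu)%:C *: (C *m s0))].
Proof.
elim: m => [_|m IH mp].
  exists [:: (s0, (fun=> 0, fun=> 0))] => gamma beta.
  have L0 : linform (fun=> 0, fun=> 0) gamma beta = 0.
    by rewrite /linform big1 // => k _; rewrite !mul0r addr0.
  rewrite !big_pred0 // take0 /expsum_eval /moment !big_seq1 /= L0 expi0.
  rewrite expr0 fact0 divr1 !scale1r mulr0 !expr0n /= !mul0r subrr mul0r.
  by rewrite !scale0r !addr0 !scaler0.
have {IH} [s sE] := IH (ltnW mp).
pose k := Ordinal mp.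
(* The coefficient -1 at [k] supplies the sign of the exponents -i gamma_k and -i beta_k. *)
have [s1 s1E] := expsum_layer (fun i => - (i == k)%:R, fun=> 0) s C_herm.
have [s2 s2E] := expsum_layer (fun=> 0, fun i => - (i == k)%:R) s1 B_herm.
exists s2 => gamma beta.
have {s2E} := s2E gamma beta; have {s1E} := s1E gamma beta.
have {sE} := sE gamma beta.
have sumS (F : 'I_p -> R) :
    \sum_(i < p | (i < m.+1)%N) F i = \sum_(i < p | (i < m)%N) F i + F k.
  rewrite (bigD1 k) //= addrC; congr (_ + _); apply: eq_bigl => i.
  by rewrite -val_eqE /= ltnS ltn_neqAle andbC.
have linG : linform (fun i => - (i == k)%:R, fun=> 0) gamma beta = - gamma k.
  rewrite /linform (bigD1 k) //= big1 ?addr0 => [|i ik].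
    by rewrite eqxx mul0r addr0 mulN1r.
  by rewrite (negbTE ik) oppr0 !mul0r addr0.
have linB : linform (fun=> 0, fun i => - (i == k)%:R) gamma beta = - beta k.
  rewrite /linform (bigD1 k) //= big1 ?addr0 => [|i ik].
    by rewrite eqxx mul0r add0r mulN1r.
  by rewrite (negbTE ik) oppr0 !mul0r addr0.
have takeS : take m.+1 (enum 'I_p) = rcons (take m (enum 'I_p)) k.
  rewrite (take_nth k) ?size_enum_ord //; congr rcons.
  by apply: val_inj; rewrite /= nth_enum_ord.
rewrite linG linB !rmorphN !mulrN -!mulNr.
move=> /= [sE s0E s1E s2E] [tE t0E t1E t2E] [uE u0E u1E u2E].
rewrite takeS /layers foldl_rcons -/(layers _ _ _ _) uE tE sE u0E t0E s0E.
split; [by [] | by [] | | ].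
  rewrite u1E t1E t0E s1E s0E B_s0 !sumS.
  move: (\sum_(i < p | _) gamma i) (\sum_(j < p | _) beta j) => G b.
  rewrite !(rmorphM (real_complex R)) !(rmorphD (real_complex R)).
  exact: first_order_step.
rewrite u2E t2E t1E t0E s2E s1E s0E !sumS -!mulr_suml.
move: (\sum_(j < p | _) \sum_(i < p | _) _) => sg.
move: (\sum_(i < p | _) gamma i) (\sum_(j < p | _) beta j) => G b.
rewrite !(mulmxDr, B_s0, =^~ scalemxAr).
rewrite -mulrDl.
have two : (2 : R)%:C = 2 :> R[i] by exact: (rmorph_nat (real_complex R)).
rewrite !(rmorphM (real_complex R), rmorphXn (real_complex R), fmorphV (real_complex R)) /=.
rewrite two !(rmorphD (real_complex R), rmorphN (real_complex R)).
rewrite !(rmorphM (real_complex R), rmorphD (real_complex R)) -!expr2.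
exact: second_order_step.
Qed.

End second_order.

(** Averaging the values at the angles and at their negatives replaces each $e^{iL}$ by cos L. Since
    the total is real, only the real parts of the weights remain. *)
Lemma expsum_even_real (R : realType) (p : nat) (s : expsum R p 1 1) :
  (forall gamma beta, Num.conj (expsum_eval s gamma beta 0 0) =
     expsum_eval s gamma beta 0 0) ->
  (forall gamma beta,
     expsum_eval s (fun k => - gamma k) (fun k => - beta k) 0 0 =
     expsum_eval s gamma beta 0 0) ->
  forall gamma beta, expsum_eval s gamma beta 0 0 =
    (\sum_(u <- s) complex.Re (u.1 0 0) * cos (linform u.2 gamma beta))%:C.
Proof.
move=> s_real s_even gamma beta.
have evalE x y : expsum_eval s x y 0 0 = \sum_(u <- s) expi (linform u.2 x y) * u.1 0 0.
  by rewrite /expsum_eval summxE; apply: eq_bigr => u _; rewrite mxE.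
have sE : expsum_eval s gamma beta 0 0 =
    \sum_(u <- s) (cos (linform u.2 gamma beta))%:C * u.1 0 0.
  apply: (mulIf (_ : (2 : R[i]) != 0)); first by rewrite pnatr_eq0.
  rewrite mulr_natr mulr2n -[in X in _ + X]s_even !evalE -big_split mulr_suml.
  apply: eq_bigr => u _ /=; rewrite -mulrDl mulrAC; congr (_ * _).
  have -> : linform u.2 (fun k => - gamma k) (fun k => - beta k) =
      - linform u.2 gamma beta.
    by rewrite /linform -sumrN; apply: eq_bigr => k _; ring.
  by rewrite /expi cosN sinN mulr_natr mulr2n; simpc.
have /CrealP/complex_realP[r rE] := s_real gamma beta.
rewrite rE; congr (_%:C); move/(congr1 (@complex.Re R)): rE => /= <-.
rewrite sE raddf_sum; apply: eq_bigr => u _ /=.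
by case: (u.1 0 0) => x y /=; rewrite mul0r subr0 mulrC.
Qed.

(** All amplitudes of [s0] have square $2^{-n}$. The first term therefore averages c(x) times the
    sum of [c] over the [n] neighbours of [x], the second averages $n c(x)^2$, and the difference
    forms [diff_sum]. *)
Lemma diff_sum_expectation (R : realType) (n : nat) (c : bits n -> R) :
  let s0 := plus_state R n in
  (s0^T *m (costH c *m (mixH R n *m (costH c *m s0)))) 0 0 -
  n%:R * (s0^T *m (costH c *m (costH c *m s0))) 0 0 =
  ((2 ^+ n)^-1 * \sum_(x : bits n) c x * diff_sum c x)%:C.
Proof.
rewrite /= plus_stateE !(costH_real_state, mixH_real_state) !real_state_dot.
rewrite -(rmorph_nat (real_complex R)) -rmorphM -rmorphB /=; congr (_%:C).
rewrite mulr_sumr mulr_sumr -sumrB; apply: eq_bigr => x _.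
set a := (Num.sqrt _)^-1.
have -> : (2 ^+ n)^-1 = a ^+ 2 :> R.
  by rewrite /a exprVn sqr_sqrtr // exprn_ge0.
rewrite -mulr_suml /diff_sum /partial_diff sumrB sumr_const card_ord.
by rewrite -mulr_natl; ring.
Qed.

(** By symmetry of [C] and [B], the terms in $G^2$ and $b^2$ cancel, and so do those in $Gb$; only
    the ordered pairs counted by [sg] survive. *)
Lemma second_moment_expectation (K : numFieldType) (N : nat) (C B : 'M[K]_N)
    (s : 'cV[K]_N) (G b nu sg : K) :
  C^T = C -> B^T = B ->
  let v := G *: (C *m s) + (b * nu) *: s in
  let w := (G ^+ 2 / 2) *: (C *m (C *m s)) + (b ^+ 2 * nu ^+ 2 / 2) *: s +
    sg *: (B *m (C *m s)) + ((G * b - sg) * nu) *: (C *m s) in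
  v^T *m (C *m v) - s^T *m (C *m w) - w^T *m (C *m s) =
  - (2 * sg) *: (s^T *m (C *m (B *m (C *m s))) - nu *: (s^T *m (C *m (C *m s)))).
Proof.
move=> Cs Bs v w; rewrite /v /w !(linearD (@trmx K _ _)).
rewrite !(linearZZ (@trmx K _ _)) /= !trmx_mul Cs Bs.
rewrite !(mulmxDr, mulmxDl, =^~ scalemxAr, =^~ scalemxAl, mulmxA).
move: (s^T *m C *m C *m C *m s) (s^T *m C *m C *m s) (s^T *m C *m s).
move: (s^T *m C *m B *m C *m s) => r q3 q2 q1.
by apply/matrixP => i j; rewrite !mxE; field.
Qed.

(** As [C], [B] and [s] are real, adjoints become transposes up to conjugating scalars:
    $\overline{(-i)}(-i) = 1$ for the product of first orders and $(-i)^2 = -1$ for the other two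
    terms. This gives the signs of [second_moment_expectation]. *)
Lemma expectation_second_order (R : realType) (N : nat) (C B : 'M[R[i]]_N)
    (s : 'cV[R[i]]_N) (G b nu sg : R) :
  map_mx Num.conj C = C -> C^T = C -> map_mx Num.conj B = B -> B^T = B ->
  map_mx Num.conj s = s ->
  let v := G%:C *: (C *m s) + (b * nu)%:C *: s in
  let w := (G ^+ 2 / 2)%:C *: (C *m (C *m s)) +
    (b ^+ 2 * nu ^+ 2 / 2)%:C *: s + sg%:C *: (B *m (C *m s)) +
    ((G * b - sg) * nu)%:C *: (C *m s) in
  (- 'i%C *: v)^t* *m (C *m (- 'i%C *: v)) +
  s^t* *m (C *m ((- 'i%C) ^+ 2 *: w)) +
  ((- 'i%C) ^+ 2 *: w)^t* *m (C *m s) =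
  - (2 * sg)%:C *:
    (s^T *m (C *m (B *m (C *m s))) - nu%:C *: (s^T *m (C *m (C *m s)))).
Proof.
move=> Cr Cs Br Bs sr v w.
have two : (2 : R)%:C = 2 :> R[i] by exact: (rmorph_nat (real_complex R)).
have adjZ z (u : 'cV[R[i]]_N) : map_mx Num.conj u = u ->
    (z *: u)^t* = Num.conj z *: u^T.
  by move=> ur; rewrite linearZ map_mxZ -map_trmx ur.
have vr : map_mx Num.conj v = v.
  by rewrite /v map_mxD !conj_realZ map_mxM Cr sr.
have wr : map_mx Num.conj w = w.
  by rewrite /w !map_mxD !conj_realZ !map_mxM Cr Br sr.
have conjNi : Num.conj (- 'i%C : R[i]) = 'i%C.
  by apply/eqP; rewrite eq_complex /= oppr0 opprK !eqxx.
have sqNi : (- 'i%C) ^+ 2 = -1 :> R[i] by rewrite sqrrN sqr_i.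
rewrite !adjZ // sqNi conjNi rmorphN1 -map_trmx sr.
rewrite -!scalemxAr -!scalemxAl scalerA !scaleN1r mulNr -expr2 sqr_i opprK scale1r.
rewrite (rmorphM (real_complex R)) /= two.
rewrite -(second_moment_expectation s G%:C b%:C nu%:C sg%:C Cs Bs) /= /v /w.
rewrite !(rmorphM (real_complex R), rmorphXn (real_complex R), fmorphV (real_complex R)) /=.
rewrite two !(rmorphD (real_complex R), rmorphN (real_complex R)).
by rewrite !(rmorphM (real_complex R)) -!expr2.
Qed.

Theorem theorem2p2p2 (R : realType) (n p : nat) (hp : (1 <= p)%N)
    (c : bits n -> R) :
  exists rest : ('I_p -> R) -> ('I_p -> R) -> R,
    power_series_of_order_ge 4 rest /\
    forall gamma beta : 'I_p -> R,
      qaoa_cost c gamma beta =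
        initial_cost c
        - (2 / 2 ^+ n
           * (\sum_(j < p) \sum_(i < p | (i <= j)%N) gamma i * beta j)
           * (\sum_(x : bits n) c x * diff_sum c x))%:C
        + (rest gamma beta)%:C.
Proof.
have Cr := costH_real c; have Cs := costH_sym c.
have Br := mixH_real R n; have Bs := mixH_sym R n.
have s0r : map_mx Num.conj (plus_state R n) = plus_state R n.
  by rewrite plus_stateE conj_real_state.
have B_s0 : mixH R n *m plus_state R n = (n%:R : R)%:C *: plus_state R n.
  rewrite plus_stateE mixH_real_state scaler_sumr; apply: eq_bigr => x _.
  by rewrite sumr_const card_ord scalerA -rmorphM mulr_natl.
have [s sE] := layers_second_order (real_symmetric_hermitian Cr Cs)
  (real_symmetric_hermitian Br Bs) B_s0 (leqnn p).
(* The bra, the cost Hamiltonian and the ket combine into a single scalar exponential sum for the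
   cost expectation. *)
pose S := expsum_mul (expsum_adj s) (expsum_lmul (costH c) s).
have SE gamma beta : expsum_eval S gamma beta 0 0 = qaoa_cost c gamma beta.
  rewrite expsum_mulE expsum_adjE expsum_lmulE.
  have [-> _ _ _] := sE gamma beta.
  by rewrite take_oversize ?size_enum_ord.
have S0 gamma beta : moment 0 S gamma beta 0 0 = initial_cost c.
  rewrite moment_mul big_ord1 moment_adj moment_lmul.
  by have [_ -> _ _] := sE gamma beta.
have S2 gamma beta : moment 2 S gamma beta 0 0 =
    - (2 / 2 ^+ n
           * (\sum_(j < p) \sum_(i < p | (i <= j)%N) gamma i * beta j)
           * (\sum_(x : bits n) c x * diff_sum c x))%:C.
  have [_ s0E s1E s2E] := sE gamma beta.
  (* The orders of bra and ket add up to 2 as 1+1, 0+2 or 2+0. *)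
  have -> : moment 2 S gamma beta =
      (moment 1 s gamma beta)^t* *m (costH c *m moment 1 s gamma beta) +
      (moment 0 s gamma beta)^t* *m (costH c *m moment 2 s gamma beta) +
      (moment 2 s gamma beta)^t* *m (costH c *m moment 0 s gamma beta).
    rewrite moment_mul !big_ord_recl big_ord0 addr0 !moment_adj !moment_lmul.
    by rewrite addrCA addrA.
  have ordT (F : 'I_p -> R) : \sum_(i < p | (i < p)%N) F i = \sum_(i < p) F i.
    by apply: eq_bigl => i; rewrite ltn_ord.
  rewrite s0E s1E s2E !ordT.
  move: (\sum_(j < p) \sum_(i < p | _) _) => sg.
  move: (\sum_i gamma i) (\sum_i beta i) => G b.
  rewrite (expectation_second_order _ _ _ _ Cr Cs Br Bs s0r).
  rewrite mxE [X in _ * X](_ : _ =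
    ((2 ^+ n)^-1 * \sum_(x : bits n) c x * diff_sum c x)%:C); last first.
    rewrite -diff_sum_expectation !mxE; congr (_ - _ * _).
    exact: (rmorph_nat (real_complex R)).
  rewrite mulNr -rmorphM; congr (- _%:C); ring.
(* The remainder is the cosine form of the cost with $1 - L^2/2$ removed from each cosine. *)
exists (fun gamma beta => \sum_(u <- S) complex.Re (u.1 0 0) *
  (cos (linform u.2 gamma beta) - 1 + linform u.2 gamma beta ^+ 2 / 2)).
split.
  apply: power_series_of_order_ge_sum => u; apply: power_series_of_order_geZ.
  exact: cos_linform_order4.
move=> gamma beta; rewrite -S2 -(S0 gamma beta) -SE.
rewrite expsum_even_real; last 2 first.
- by move=> x y; rewrite SE quantum_expectation_real.
- move=> x y; rewrite !SE /qaoa_cost qaoa_state_opp quantum_expectation_conj //.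
  exact: quantum_expectation_real.
have real_Re (z : R[i]) : Num.conj z = z -> z = (complex.Re z)%:C.
  by move=> /CrealP/complex_realP[r ->].
(* Moments 0 and 2 are real by their closed forms, so real parts can be taken weight by weight; they
   then match exactly what was removed from the cosines. *)
have m0 : moment 0 S gamma beta 0 0 = (\sum_(u <- S) complex.Re (u.1 0 0))%:C.
  rewrite [LHS]real_Re; last by rewrite S0 quantum_expectation_real.
  congr (_%:C); rewrite /moment summxE raddf_sum; apply: eq_bigr => u _ /=.
  by rewrite mxE expr0 fact0 divr1 mul1r.
have m2 : moment 2 S gamma beta 0 0 =
    (\sum_(u <- S) - (linform u.2 gamma beta ^+ 2 / 2 * complex.Re (u.1 0 0)))%:C.
  rewrite [LHS]real_Re; last by rewrite S2 -rmorphN conj_real.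
  congr (_%:C); rewrite /moment summxE raddf_sum; apply: eq_bigr => u _ /=.
  rewrite mxE exprMn sqr_i mulN1r -rmorphXn -(rmorph_nat (real_complex R)) mulNr.
  rewrite -fmorphV -rmorphM /=.
  by case: (u.1 0 0) => x y /=; rewrite mulNr oppr0 mul0r subr0.
rewrite m0 m2 -!rmorphD -!big_split; congr (_%:C).
by apply: eq_bigr => u _ /=; ring.
Qed.
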